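(* Let $p$ be a prime, let $a,c\in\mathbb{Q}_p$ with $ac\neq 0$ and $\sqrt{c^2-4a}\in\mathbb{Q}_p$, and let $f(x)=\frac{ax}{x^2+cx+a}$ for $x\in\mathbb{Q}_p$ with $x\neq \frac{-c\pm\sqrt{c^2-4a}}{2}$. If $\sqrt{c^2-2a}\in\mathbb{Q}_p$, then the function $f$ has a unique $2$-periodic orbit $\{t_1,t_2\}$, where $t_{1,2}=-c\pm\sqrt{c^2-2a}$.
   Context: $\mathbb{Q}_p$ is the field of $p$-adic numbers; for $u\in\mathbb{Q}_p$, $\sqrt{u}\in\mathbb{Q}_p$ means that $u$ has a square root in $\mathbb{Q}_p$. A $2$-periodic orbit of $f$ is the orbit $\{x,f(x)\}$ of a point $x\in\mathbb{Q}_p$ with $f(f(x))=x$ and $f(x)\neq x$.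
   Formalization: The formal theorem also assumes c^2-2a ≠ 0: if c^2=2a then t_1=t_2=-c is a fixed point and f has no 2-periodic orbit (e.g. p=5, a=c=2, where c^2-4a=-4 is a square in Q_5). *)

(* Defs.v *)
From HB Require Import structures.
From mathcomp Require Import all_boot all_order all_algebra.
From mathcomp Require Import boolp classical_sets functions.
From mathcomp Require Import generic_quotient ring_quotient ring zify.

Set Implicit Arguments.
Unset Strict Implicit.
Unset Printing Implicit Defensive.

Import Order.TTheory GRing.Theory Num.Theory.
Local Open Scope ring_scope.

(* The field Q_p of p-adic numbers is built as the completion of Q for the    *)
(* p-adic absolute value: the ring of Cauchy sequences of rationals, modulo   *)
(* the ideal of null sequences.                                               *)

Section PadicNorm.
Variables (p : nat) (p_pr : prime p).
Implicit Types x y : rat.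

Definition padic_val (x : rat) : int :=
  (logn p `|numq x|)%:Z - (logn p `|denq x|)%:Z.

Definition padic_norm (x : rat) : rat :=
  if x == 0 then 0 else p%:R ^ (- padic_val x).

Lemma padic_val_frac (u v : int) : u != 0 -> v != 0 ->
  padic_val (u%:~R / v%:~R) = (logn p `|u|)%:Z - (logn p `|v|)%:Z.
Proof.
move=> u0 v0; set x : rat := _ / _.
have x0 : x != 0 by rewrite mulf_neq0 ?invr_eq0 ?intr_eq0.
have /(congr1 (logn p)) : (`|numq x| * `|v| = `|u| * `|denq x|)%N.
  rewrite -!abszM; congr absz; apply: (@intr_inj rat); rewrite !intrM.
  have dx0 : (denq x)%:~R != 0 :> rat by rewrite intr_eq0 denq_neq0.
  have v0' : v%:~R != 0 :> rat by rewrite intr_eq0.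
  have := divq_num_den x; rewrite {3}/x => /(canRL (divfK dx0)) ->.
  by field.
rewrite !lognM ?absz_gt0 ?denq_neq0 ?numq_eq0 //; rewrite /padic_val => E.
by apply/eqP; rewrite subr_eq addrAC eq_sym subr_eq -!PoszD E.
Qed.

Lemma padic_valM x y : x != 0 -> y != 0 ->
  padic_val (x * y) = padic_val x + padic_val y.
Proof.
move=> x0 y0; rewrite -{1}[x]divq_num_den -{1}[y]divq_num_den mulf_div -!intrM.
rewrite padic_val_frac ?mulf_neq0 ?denq_neq0 ?numq_eq0 //.
rewrite !abszM !lognM ?absz_gt0 ?denq_neq0 ?numq_eq0 // /padic_val !PoszD.
ring.
Qed.

Lemma padic_valD x y : x != 0 -> y != 0 -> x + y != 0 ->
  Num.min (padic_val x) (padic_val y) <= padic_val (x + y).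
Proof.
move=> x0 y0 xy0; have := xy0.
have xE := divq_num_den x; have yE := divq_num_den y.
have dx0 : (denq x)%:~R != 0 :> rat by rewrite intr_eq0 denq_neq0.
have dy0 : (denq y)%:~R != 0 :> rat by rewrite intr_eq0 denq_neq0.
have -> : x + y = (numq x * denq y + numq y * denq x)%:~R
                  / (denq x * denq y)%:~R.
  rewrite -{1}xE -{1}yE intrD !intrM; field.
  by rewrite dx0 dy0.
rewrite mulf_eq0 invr_eq0 !intr_eq0 negb_or => /andP[s0 d0].
rewrite padic_val_frac // /padic_val.
set s := numq x * _ + _ in s0 *.
have nx0 : numq x != 0 by rewrite numq_eq0.
have ny0 : numq y != 0 by rewrite numq_eq0.
have key (k : nat) : (k <= logn p `|(numq x * denq y)%R|)%N ->
    (k <= logn p `|(numq y * denq x)%R|)%N -> (k <= logn p `|s|)%N.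
  rewrite -!pfactor_dvdn ?absz_gt0 ?mulf_neq0 ?denq_neq0 // => h1 h2.
  suff : ((p ^ k)%:Z %| s)%Z by [].
  by apply: rpredD.
move: key; rewrite !abszM !lognM ?absz_gt0 ?denq_neq0 //.
move: (logn p `|numq x|) (logn p `|denq x|) (logn p `|numq y|)
  (logn p `|denq y|) (logn p `|s|) => nx dx ny dy t /(_ (minn (nx + dy) (ny + dx))).
rewrite geq_minl geq_minr => /(_ isT isT); rewrite PoszD geq_min.
rewrite ge_min => /orP[] h; apply/orP; [left|right]; lia.
Qed.

Let p_gt0 : 0 < p%:R :> rat. Proof. by rewrite ltr0n prime_gt0. Qed.

Lemma padic_norm0 : padic_norm 0 = 0. Proof. by rewrite /padic_norm eqxx. Qed.

Lemma padic_norm_ge0 x : 0 <= padic_norm x.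
Proof. by rewrite /padic_norm; case: ifP => // _; rewrite exprz_ge0 // ltW. Qed.

Lemma padic_norm_eq0 x : (padic_norm x == 0) = (x == 0).
Proof.
rewrite /padic_norm; case: (eqVneq x 0) => [_|//]; first by rewrite eqxx.
by move=> x0; rewrite expfz_eq0 (gt_eqF p_gt0) andbF.
Qed.

Lemma padic_normM x y : padic_norm (x * y) = padic_norm x * padic_norm y.
Proof.
rewrite /padic_norm mulf_eq0.
case: eqVneq => [|x0]; first by rewrite mul0r.
case: eqVneq => [|y0]; first by rewrite mulr0.
by rewrite padic_valM // opprD expfzDr // gt_eqF.
Qed.

Lemma padic_norm1 : padic_norm 1 = 1.
Proof.
have := padic_normM 1 1; rewrite mulr1 => /eqP.
by rewrite -{1}[padic_norm 1]mulr1 (inj_eq (mulfI _)) ?padic_norm_eq0 // => /eqP.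
Qed.

Lemma padic_normN x : padic_norm (- x) = padic_norm x.
Proof. by rewrite /padic_norm oppr_eq0 /padic_val numqN denqN abszN. Qed.

Lemma padic_normV x : padic_norm x^-1 = (padic_norm x)^-1.
Proof.
have [->|x0] := eqVneq x 0; first by rewrite invr0 padic_norm0.
have n0 : padic_norm x != 0 by rewrite padic_norm_eq0.
by apply: (mulfI n0); rewrite -padic_normM !divff // padic_norm1.
Qed.

Lemma padic_normD x y :
  padic_norm (x + y) <= Num.max (padic_norm x) (padic_norm y).
Proof.
have [->|x0] := eqVneq x 0; first by rewrite add0r le_max lexx orbT.
have [->|y0] := eqVneq y 0; first by rewrite addr0 le_max lexx.
have [->|xy0] := eqVneq (x + y) 0.
  by rewrite padic_norm0 le_max padic_norm_ge0.
have := padic_valD x0 y0 xy0.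
rewrite /padic_norm (negPf x0) (negPf y0) (negPf xy0) ge_min le_max.
have p1 : 1 < p%:R :> rat by rewrite ltr1n prime_gt1.
by rewrite !(ler_eXz2l p1) !lerN2.
Qed.

Lemma padic_normD_lt x y e :
  padic_norm x < e -> padic_norm y < e -> padic_norm (x + y) < e.
Proof.
by move=> xe ye; apply: le_lt_trans (padic_normD x y) _; rewrite gt_max xe.
Qed.

End PadicNorm.

Definition padic_cauchy (p : nat) (u : nat -> rat) : Prop :=
  forall e : rat, 0 < e -> exists N : nat, forall m n : nat,
    (N <= m)%N -> (N <= n)%N -> padic_norm p (u m - u n) < e.

Definition padic_null (p : nat) (u : nat -> rat) : Prop :=
  forall e : rat, 0 < e -> exists N : nat, forall n : nat,
    (N <= n)%N -> padic_norm p (u n) < e.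

Section CauchyRing.
Variables (p : nat) (p_pr : prime p).
Local Notation N := (padic_norm p).
Implicit Types u v : nat -> rat.

Lemma padic_cauchy_bounded u : padic_cauchy p u ->
  exists2 B, 0 < B & exists M, forall n, (M <= n)%N -> N (u n) < B.
Proof.
move=> /(_ 1 ltr01) [M hM]; exists (1 + N (u M)).
  by rewrite ltr_wpDr ?padic_norm_ge0.
exists M => n Mn; rewrite -[u n](subrK (u M)).
apply: padic_normD_lt => //; last by rewrite ltrDr.
by apply: lt_le_trans (hM _ _ Mn (leqnn M)) _; rewrite lerDl padic_norm_ge0.
Qed.

Lemma padic_null_mul u v :
  padic_cauchy p u -> padic_null p v -> padic_null p (u * v).
Proof.
move=> /padic_cauchy_bounded[B B0 [M hM]] v0 e e0.
have [K hK] := v0 _ (divr_gt0 e0 B0).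
exists (maxn M K) => n; rewrite geq_max => /andP[/hM h1 /hK h2].
rewrite padic_normM // -[e](mulrVK (unitf_gt0 B0)) mulrC.
by apply: ltr_pM; rewrite ?padic_norm_ge0.
Qed.

Lemma padic_cauchy_subring :
  subring_closed (fun u : nat -> rat => `[< padic_cauchy p u >]).
Proof.
split=> [|u v /asboolP cu /asboolP cv|u v /asboolP cu /asboolP cv]; apply/asboolP.
- by move=> e e0; exists 0%N => m n _ _; rewrite subrr padic_norm0.
- move=> e e0; have [M hM] := cu e e0; have [K hK] := cv e e0.
  exists (maxn M K) => m n; rewrite !geq_max => /andP[m1 m2] /andP[n1 n2].
  have -> : (u - v) m - (u - v) n = (u m - u n) - (v m - v n) by rewrite !(addrfctE, opprfctE); ring.
  by apply: padic_normD_lt; rewrite ?padic_normN ?hM ?hK.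
have [A A0 [J hJ]] := padic_cauchy_bounded cu.
have [B B0 [L hL]] := padic_cauchy_bounded cv.
move=> e e0; have [M hM] := cu _ (divr_gt0 e0 B0).
have [K hK] := cv _ (divr_gt0 e0 A0).
exists (maxn (maxn J L) (maxn M K)) => m n; rewrite !geq_max.
move=> /andP[/andP[m1 m2] /andP[m3 m4]] /andP[/andP[n1 n2] /andP[n3 n4]].
have -> : (u * v) m - (u * v) n = (u m - u n) * v m + u n * (v m - v n).
  by rewrite !mulrfctE; ring.
apply: padic_normD_lt => //; rewrite padic_normM //.
  rewrite -[e](mulrVK (unitf_gt0 B0)).
  by apply: ltr_pM; rewrite ?padic_norm_ge0 ?hM ?hL.
rewrite mulrC -[e](mulrVK (unitf_gt0 A0)).
by apply: ltr_pM; rewrite ?padic_norm_ge0 ?hK ?hJ.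
Qed.

End CauchyRing.

(* The primality proof is a parameter so that the ring structure, which needs *)
(* the norm to be multiplicative, can be attached to the type.                *)
Record padic_seq (p : nat) (p_pr : prime p) : Type := PadicSeq {
  padic_seq_val : nat -> rat;
  _ : `[< padic_cauchy p padic_seq_val >]
}.

Section PadicField.
Variables (p : nat) (p_pr : prime p).
Local Notation N := (padic_norm p).
Local Notation C := (padic_seq p_pr).

HB.instance Definition _ := [isSub for @padic_seq_val p p_pr].
HB.instance Definition _ := [Choice of C by <:].
HB.instance Definition _ := GRing.SubChoice_isSubComNzRing.Build
  (nat -> rat) (fun u => `[< padic_cauchy p u >]) C (padic_cauchy_subring p_pr).

Definition null_pred : {pred C} := fun u => `[< padic_null p (val u) >].

Lemma null_pred_idealr : idealr_closed null_pred.
Proof.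
split.
- by apply/asboolP => e e0; exists 0%N => n _; rewrite padic_norm0.
- apply/asboolPn => /(_ 1 ltr01)[M /(_ M (leqnn M))].
  by rewrite padic_norm1 // ltxx.
move=> a u v /asboolP u0 /asboolP v0; apply/asboolP => e e0.
have [M hM] := padic_null_mul p_pr (asboolW (valP a)) u0 e0.
have [K hK] := v0 e e0.
exists (maxn M K) => n; rewrite geq_max => /andP[/hM h1 /hK h2].
exact: padic_normD_lt.
Qed.

HB.instance Definition _ := isIdealr.Build C null_pred null_pred_idealr.

Definition Qp : Type := {ideal_quot null_pred}.
HB.instance Definition _ := GRing.ComNzRing.on Qp.
HB.instance Definition _ := EqQuotient.on Qp.

(* Pointwise inverse; the finitely many zero terms of a non-null Cauchy       *)
(* sequence are harmless as 0^-1 = 0 in rat.                                  *)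
Definition padic_seq_inv (u : C) : C :=
  if u \in null_pred then 0 else insubd 0 (fun n => (val u n)^-1).

Definition Qp_inv (x : Qp) : Qp := \pi_Qp%qT (padic_seq_inv (repr x)).

Lemma non_null_bounded (u : C) : u \notin null_pred ->
  exists2 e, 0 < e & exists M, forall n, (M <= n)%N -> e <= N (val u n).
Proof.
move=> /asboolPn u0.
have [e e0 he] : exists2 e, 0 < e & forall M, exists2 n, (M <= n)%N & e <= N (val u n).
  apply: contrapT => h; apply: u0 => e e0; apply: contrapT => h2; apply: h.
  exists e => // M; apply: contrapT => h3; apply: h2; exists M => n Mn.
  by rewrite ltNge; apply/negP => h4; apply: h3; exists n.
exists e => //; have [M hM] := asboolW (valP u) e e0.
exists M => n Mn; have [k Mk] := he M; rewrite !leNgt; apply: contra => h.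
by rewrite -[val u k](subrK (val u n)); apply: padic_normD_lt; rewrite ?hM.
Qed.

Lemma padic_seq_invP (u : C) : u \notin null_pred ->
  val (padic_seq_inv u) = (fun n => (val u n)^-1).
Proof.
move=> u0; rewrite /padic_seq_inv (negPf u0) val_insubd ifT //.
have [d d0 [M hM]] := non_null_bounded u0.
apply/asboolP => e e0.
have [K hK] := asboolW (valP u) (e * (d * d)) (mulr_gt0 e0 (mulr_gt0 d0 d0)).
exists (maxn M K) => m n; rewrite !geq_max => /andP[m1 m2] /andP[n1 n2].
have hm := hM m m1; have hn := hM n n1.
have Nm := lt_le_trans d0 hm; have Nn := lt_le_trans d0 hn.
have m0 : val u m != 0 by rewrite -(padic_norm_eq0 p_pr) gt_eqF.
have n0 : val u n != 0 by rewrite -(padic_norm_eq0 p_pr) gt_eqF.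
have -> : (val u m)^-1 - (val u n)^-1 = (val u n - val u m) / (val u m * val u n).
  by field; rewrite m0 n0.
rewrite !(padic_normM p_pr) (padic_normV p_pr) (padic_normM p_pr).
rewrite ltr_pdivrMr ?mulr_gt0 //; apply: lt_le_trans (hK n m n2 m2) _.
by rewrite ler_pM2l // ler_pM // ltW.
Qed.

Lemma Qp_eq0 (x : Qp) : (x == 0) = (repr x \in null_pred).
Proof.
have := Quotient.idealrBE null_pred (repr x) 0.
rewrite subr0 => ->; rewrite reprK; congr (_ == _).
by rewrite !piE.
Qed.

Lemma Qp_mulVf (x : Qp) : x != 0 -> Qp_inv x * x = 1.
Proof.
rewrite Qp_eq0 => x0; rewrite -{2}[x]reprK.
set u := repr x in x0 *; rewrite /Qp_inv -/u -rmorphM -[1](rmorph1 \pi_Qp%qT).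
apply/eqP; rewrite -Quotient.idealrBE; apply/asboolP => e e0.
have [d d0 [M hM]] := non_null_bounded x0.
exists M => n Mn; rewrite rmorphB rmorphM rmorph1 /= padic_seq_invP //.
rewrite opprfctE addrfctE mulrfctE /= mulVf ?subrr ?padic_norm0 //.
by rewrite -(padic_norm_eq0 p_pr) gt_eqF // (lt_le_trans d0) ?hM.
Qed.

Lemma Qp_inv0 : Qp_inv 0 = 0.
Proof.
rewrite /Qp_inv /padic_seq_inv -Qp_eq0 eqxx; exact: rmorph0.
Qed.

HB.instance Definition _ := GRing.ComNzRing_isField.Build Qp Qp_mulVf Qp_inv0.

Lemma Qp_natr_eq0 n : (n%:R == 0 :> Qp) = (n == 0)%N.
Proof.
rewrite -(rmorph_nat \pi_Qp%qT).
have -> : (0 : Qp) = \pi_Qp%qT (0 : C) by rewrite rmorph0.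
rewrite -Quotient.idealrBE subr0.
have [->|n0] := eqVneq n 0%N; first by rewrite rpred0.
apply/asboolPn => h; have [|M /(_ M (leqnn M))] := h (N n%:R).
  by rewrite lt0r padic_norm_ge0 // padic_norm_eq0 // pnatr_eq0 n0.
suff -> : val (n%:R : C) M = n%:R by rewrite ltxx.
elim: n {n0 h} => // k IH; rewrite !mulrS -IH.
by rewrite rmorphD rmorph1.
Qed.

End PadicField.

Local Open Scope classical_set_scope.

(* A partial function K -> K is given by a total f and its domain D.          *)
Definition periodic2_point (K : Type) (D : set K) (f : K -> K) (x : K) : Prop :=
  [/\ D x, D (f x), f (f x) = x & f x <> x].

Definition periodic2_orbit (K : Type) (D : set K) (f : K -> K) (O : set K) : Prop :=
  exists2 x, periodic2_point D f x & O = [set x; f x].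

Definition ratfun (K : fieldType) (a c x : K) : K :=
  a * x / (x ^+ 2 + c * x + a).

(* [d] stands for a square root of c^2 - 4a. *)
Definition ratfun_dom (K : fieldType) (c d : K) : set K :=
  [set x | x <> (- c + d) / 2%:R /\ x <> (- c - d) / 2%:R].

(* Main.v *)
Require Import Defs.
From mathcomp Require Import all_boot all_order all_algebra.
From mathcomp Require Import boolp classical_sets.
From mathcomp Require Import ring.

Import GRing.Theory.
Local Open Scope classical_set_scope.
Local Open Scope ring_scope.

(** The argument is purely algebraic and holds in every field where 2 is
    invertible.  Write q(x) = x^2 + c x + a, so that f(x) = a x / q(x); the two
    excluded points are exactly the roots of q.  If y = f(x) and x = f(y), then
    a x = y q(x) and a y = x q(y).  Subtracting gives (x - y)(2a - x y) = 0, so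
    a pair of distinct points satisfies x y = 2a; substituting this back gives
    x + y = - 2c.  Hence x and y are the two roots of t^2 + 2c t + 2a, namely
    - c + s and - c - s, which proves uniqueness ([swapped_pair_vieta],
    [periodic2_point_root]).

    Conversely, on a root t of t^2 + 2c t + 2a the denominator is
    q(t) = - c t - a.  It does not vanish, and the Vieta relations give
    t' q(t) = a t for the other root t', that is, f(t) = t'
    ([ratfun_conj_root]).  The two roots differ because their difference 2s is
    nonzero.  In [Qp] the number 2 is nonzero for every p, including p = 2. *)

Section PeriodTwo.
Variables (K : fieldType) (a c : K).
Hypotheses (two0 : 2%:R != 0 :> K) (a0 : a != 0).

Lemma ratfun_domP (d x : K) : d ^+ 2 = c ^+ 2 - 4%:R * a ->
  ratfun_dom c d x <-> x ^+ 2 + c * x + a != 0.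
Proof.
move=> hd.
have qE : x ^+ 2 + c * x + a = (x - (- c + d) / 2%:R) * (x - (- c - d) / 2%:R).
  have four0 : 4%:R != 0 :> K by rewrite (natrM _ 2 2) mulf_neq0.
  have -> : a = (c ^+ 2 - d ^+ 2) / 4%:R by rewrite hd; field.
  by field; rewrite two0.
rewrite qE mulf_eq0 negb_or !subr_eq0 /ratfun_dom /=.
by split=> [[/eqP -> /eqP ->] | /andP[/eqP ? /eqP ?]].
Qed.

(** The equations are those of f(x) = y and f(y) = x with the denominators
    cleared.  Their difference has the factor x - y, and cancelling it is what
    separates 2-periodic points from fixed points. *)
Lemma swapped_pair_vieta (x y : K) : x != y -> x != 0 ->
    y * (x ^+ 2 + c * x + a) = a * x -> x * (y ^+ 2 + c * y + a) = a * y ->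
  y = - (2%:R * c) - x /\ (x + c) ^+ 2 = c ^+ 2 - 2%:R * a.
Proof.
move=> xy x0 e1 e2.
have xyE : x * y = 2%:R * a.
  have /eqP : (x - y) * (2%:R * a - x * y) = 0.
    have -> : (x - y) * (2%:R * a - x * y) =
        (a * x - y * (x ^+ 2 + c * x + a)) -
        (a * y - x * (y ^+ 2 + c * y + a)) by ring.
    by rewrite e1 e2 !subrr.
  by rewrite mulf_eq0 !subr_eq0 (negPf xy) => /eqP.
have yE : y = - (2%:R * c) - x.
  have /eqP : a * (x + y + 2%:R * c) = 0.
    (* Reducing y q(x) - a x modulo x y - 2a leaves a (x + y + 2c). *)
    have -> : a * (x + y + 2%:R * c) =
        (y * (x ^+ 2 + c * x + a) - a * x) - (x + c) * (x * y - 2%:R * a)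
        by ring.
    by rewrite e1 xyE !subrr mulr0 subr0.
  rewrite mulf_eq0 (negPf a0) /= => /eqP sumE.
  by apply/eqP; rewrite -subr_eq0 -sumE; apply/eqP; ring.
split=> //; rewrite -xyE yE; ring.
Qed.

Lemma periodic2_point_root (d s x : K) :
    d ^+ 2 = c ^+ 2 - 4%:R * a -> s ^+ 2 = c ^+ 2 - 2%:R * a ->
    periodic2_point (ratfun_dom c d) (ratfun a c) x ->
  ratfun a c x = - (2%:R * c) - x /\ (x = - c + s \/ x = - c - s).
Proof.
move=> hd hs [/(ratfun_domP _ _ hd) qx /(ratfun_domP _ _ hd) qy fy fx].
have x0 : x != 0.
  by apply/eqP => x0; apply: fx; rewrite x0 /ratfun mulr0 mul0r.
have yx : x != ratfun a c x by apply/eqP => /esym.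
have e1 : ratfun a c x * (x ^+ 2 + c * x + a) = a * x by rewrite divfK.
move: (ratfun a c x) qy fy yx e1 {fx} => y qy fy xy e1.
have e2 : x * (y ^+ 2 + c * y + a) = a * y by rewrite -{1}fy divfK.
have [yE xE] := swapped_pair_vieta _ _ xy x0 e1 e2; split=> //.
have /eqP : (x + c) ^+ 2 = s ^+ 2 by rewrite xE hs.
rewrite eqf_sqr => /orP[] /eqP e; [left | right];
  by rewrite -[x](addrK c) e addrC.
Qed.

(** Stated for either square root [s], so that replacing [s] by [- s] gives the
    image of the other root. *)
Lemma ratfun_conj_root (s : K) : s ^+ 2 = c ^+ 2 - 2%:R * a ->
  let t := - c + s in
  t ^+ 2 + c * t + a != 0 /\ ratfun a c t = - c - s.
Proof.
move=> hs t.
have qt : t ^+ 2 + c * t + a = c ^+ 2 - a - c * s.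
  have -> : t ^+ 2 + c * t + a = s ^+ 2 - c * s + a by rewrite /t; ring.
  by rewrite hs; ring.
have q0 : t ^+ 2 + c * t + a != 0.
  (* Multiplying by the conjugate c^2 - a + c s turns q(t) into a^2. *)
  have aE : (c ^+ 2 - a - c * s) * (c ^+ 2 - a + c * s) = a ^+ 2.
    have -> : (c ^+ 2 - a - c * s) * (c ^+ 2 - a + c * s) =
        (c ^+ 2 - a) ^+ 2 - c ^+ 2 * s ^+ 2 by ring.
    by rewrite hs; ring.
  rewrite qt; apply: contraNneq a0 => q0.
  by rewrite -sqrf_eq0 -aE q0 mul0r.
split=> //; apply: (mulIf q0); rewrite /ratfun divfK // qt.
have -> : (- c - s) * (c ^+ 2 - a - c * s) =
    a * (c + s) + c * (s ^+ 2 - c ^+ 2) by ring.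
by rewrite hs /t; ring.
Qed.

Lemma ratfun_unique_periodic2_orbit (d s : K) :
    d ^+ 2 = c ^+ 2 - 4%:R * a -> s ^+ 2 = c ^+ 2 - 2%:R * a -> s != 0 ->
  unique (periodic2_orbit (ratfun_dom c d) (ratfun a c))
    [set - c + s; - c - s].
Proof.
move=> hd hs s0; split.
  have [q1 f1] := ratfun_conj_root _ hs.
  have hs' : (- s) ^+ 2 = c ^+ 2 - 2%:R * a by rewrite sqrrN.
  have [q2 f2] := ratfun_conj_root _ hs'; rewrite opprK in f2.
  exists (- c + s); last by rewrite f1.
  split; rewrite ?f1 //; [exact/(ratfun_domP _ _ hd).. |].
  move/addrI/eqP; rewrite eq_sym -subr_eq0 opprK -mulr2n -mulr_natl.
  by rewrite mulf_eq0 (negPf two0) (negPf s0).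
move=> O [x /(periodic2_point_root _ _ _ hd hs)[-> xE] ->].
have conj1 : - (2%:R * c) - (- c + s) = - c - s by ring.
have conj2 : - (2%:R * c) - (- c - s) = - c + s by ring.
by case: xE => ->; rewrite ?conj1 // conj2 setUC.
Qed.

End PeriodTwo.

Theorem theorem8 (p : nat) (p_pr : prime p) (a c d s : Qp p_pr)
    (hac : a * c != 0)
    (hd : d ^+ 2 = c ^+ 2 - 4%:R * a)
    (hs : s ^+ 2 = c ^+ 2 - 2%:R * a)
    (hne : c ^+ 2 - 2%:R * a != 0) :
  unique (periodic2_orbit (ratfun_dom c d) (ratfun a c))
    [set - c + s; - c - s].
Proof.
have [a0 _] : a != 0 /\ c != 0 by apply/andP; rewrite -negb_or -mulf_eq0.
apply: ratfun_unique_periodic2_orbit => //; first by rewrite Qp_natr_eq0.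
by rewrite -sqrf_eq0 hs.
Qed.
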